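(* Let $\mathcal{C}=(\mathcal{C},\star,I,\diamond,J,\partial_l,\partial_r)$ be a linearly distributive category with negations $S,S':\mathcal{C}^{\mathrm{op}}\to\mathcal{C}$, with evaluations $e_A:SA\star A\to J$, $e'_A:A\star S'A\to J$ and coevaluations $n_A:I\to A\diamond SA$, $n'_A:I\to S'A\diamond A$. Let $G=(G,\delta,\epsilon)$ be a comonad on $\mathcal{C}$ which is monoidal with respect to $(\star,I)$ via $(\phi,\phi_0)$ and with respect to $(\diamond,J)$ via $(\psi,\psi_0)$, and suppose that for all $G$-coalgebras (with underlying objects) $A,B,C$ $$G(\partial_l)\circ\phi_{A,B\diamond C}\circ(1_{GA}\star\psi_{B,C})=\psi_{A\star B,C}\circ(\phi_{A,B}\diamond 1_{GC})\circ\partial_l,$$ $$G(\partial_r)\circ\phi_{B\diamond C,A}\circ(\psi_{B,C}\star 1_{GA})=\psi_{B,C\star A}\circ(1_{GB}\diamond\phi_{C,A})\circ\partial_r$$ (so that $\mathcal{C}^G$ is linearly distributive). Suppose $S$ and $S'$ may be lifted to $\mathcal{C}^G$ by means of natural transformations $\nu:S\to GSG$ and $\nu':S'\to GS'G$. Then the following are equivalent. (i) For every object $A$ of $\mathcal{C}$ the four equations hold: $$\psi_0\circ e_A\circ(1_{SA}\star\epsilon_A)=G(e_{GA})\circ\phi_{SGA,GA}\circ(\nu_A\star\delta_A):SA\star GA\to GJ,$$ $$G(1\diamond S\epsilon_A)\circ G(n_A)\circ\phi_0=G(1\diamond S\delta_A)\circ\psi_{A,SG^2A}\circ(1\diamond\nu_{GA})\circ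 n_{GA}:I\to G(A\diamond SGA),$$ $$\psi_0\circ e'_A\circ(\epsilon_A\star1_{S'A})=G(e'_{GA})\circ\phi_{GA,S'GA}\circ(\delta_A\star\nu'_A):GA\star S'A\to GJ,$$ $$G(S'\epsilon_A\diamond1)\circ G(n'_A)\circ\phi_0=G(S'\delta_A\diamond1)\circ\psi_{S'G^2A,A}\circ(\nu'_{GA}\diamond1)\circ n'_{GA}:I\to G(S'GA\diamond A).$$ (ii) $\mathcal{C}^G$ is a linearly distributive category with negations, the negations being the lifted functors $\widetilde S,\widetilde{S'}:(\mathcal{C}^G)^{\mathrm{op}}\to\mathcal{C}^G$ and the evaluations and coevaluations being those of $\mathcal{C}$ (that is, for every $G$-coalgebra the morphisms $e_A,e'_A,n_A,n'_A$ are $G$-coalgebra morphisms).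
   Context: Monoidal structures are taken to be strict for simplicity (this is not essential). A linearly distributive category is a category $\mathcal{C}$ with two monoidal structures $(\star,I)$ and $(\diamond,J)$ (no symmetry is assumed) and natural transformations (linear distributions) $\partial_l:A\star(B\diamond C)\to(A\star B)\diamond C$, $\partial_r:(B\diamond C)\star A\to B\diamond(C\star A)$, satisfying the Cockett–Seely coherence conditions. In the strict case: $\partial_l$ is the identity when $A=I$ or $C=J$; $\partial_r$ is the identity when $A=I$ or $B=J$; the two evident composites of linear distributions agree for $A\star B\star(C\diamond D)\to(A\star B\star C)\diamond D$, for $A\star(B\diamond C\diamond D)\to(A\star B)\diamond C\diamond D$, for the two mirror-image cases for $\partial_r$, for $A\star(B\diamond C)\star D\to(A\star B)\diamond(C\star D)$, and for $(A\diamond B)\star(C\diamond D)\to A\diamond(B\star C)\diamond D$. A linearly distributive category with negations is a linearly distributive category equipped with functors $S,S':\mathcal{C}^{\mathrm{op}}\to\mathcal{C}$ and dinatural families $e_A:SA\star A\to J$, $e'_A:A\star S'A\to J$, $n_A:I\to A\diamond SA$, $n'_A:I\to S'A\diamond A$ satisfying the four triangle identities: $A=I\star A\xrightarrow{n\star1}(A\diamond SA)\star A\xrightarrow{\partial_r}A\diamond(SA\star A)\xrightarrow{1\diamond e}A\diamond J=A$ is $1_A$; $SA\xrightarrow{1\star n}SA\star(A\diamond SA)\xrightarrow{\partial_l}(SA\star A)\diamond SA\xrightarrow{e\diamond1}SA$ is $1_{SA}$; $A\xrightarrow{1\star n'}A\star(S'A\diamond A)\xrightarrow{\partial_l}(A\star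 S'A)\diamond A\xrightarrow{e'\diamond1}A$ is $1_A$; $S'A\xrightarrow{n'\star1}(S'A\diamond A)\star S'A\xrightarrow{\partial_r}S'A\diamond(A\star S'A)\xrightarrow{1\diamond e'}S'A$ is $1_{S'A}$. A comonad $(G,\delta,\epsilon)$ is monoidal with respect to a monoidal structure if $G$ is a (lax) monoidal functor with the given structure maps ($\phi_{A,B}:GA\star GB\to G(A\star B)$, $\phi_0:I\to GI$, resp. $\psi_{A,B}:GA\diamond GB\to G(A\diamond B)$, $\psi_0:J\to GJ$) and $\delta:G\to G^2$, $\epsilon:G\to1$ are monoidal natural transformations. $\mathcal{C}^G$ is the category of Eilenberg–Moore coalgebras $(A,\gamma:A\to GA)$. Its two lifted monoidal structures are $(A,\gamma_A)\star(B,\gamma_B)=(A\star B,\phi_{A,B}\circ(\gamma_A\star\gamma_B))$ with unit $(I,\phi_0)$, and $(A,\gamma_A)\diamond(B,\gamma_B)=(A\diamond B,\psi_{A,B}\circ(\gamma_A\diamond\gamma_B))$ with unit $(J,\psi_0)$; its linear distributions are those of $\mathcal{C}$. ''$S$ may be lifted to $\mathcal{C}^G$ by means of $\nu$'' means that $\nu:S\to GSG$ is a natural transformation satisfying $\epsilon_{SGA}\circ\nu_A=S\epsilon_A$ and $\delta_{SGA}\circ\nu_A=G^2S(\delta_A)\circ G(\nu_{GA})\circ\nu_A$ for all $A$. The lifted functor $\widetilde S:(\mathcal{C}^G)^{\mathrm{op}}\to\mathcal{C}^G$ is then $\widetilde S(A,\gamma)=(SA,\ SA\xrightarrow{\nu_A}GSGA\xrightarrow{GS\gamma}GSA)$,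 $\widetilde S(f)=Sf$. Likewise for $S'$ with $\nu':S'\to GS'G$. *)

(* Defs.v *)
From Corelib Require Import ssreflect.
From Stdlib Require Import ProofIrrelevance.

Set Implicit Arguments.
Unset Strict Implicit.
Unset Printing Implicit Defensive.

Record category := Category {
  ob :> Type;
  hom : ob -> ob -> Type;
  idm : forall A, hom A A;
  comp : forall A B C, hom B C -> hom A B -> hom A C;
  comp1m : forall A B (f : hom A B), comp (idm B) f = f;
  compm1 : forall A B (f : hom A B), comp f (idm A) = f;
  compA : forall A B C D (h : hom C D) (g : hom B C) (f : hom A B),
    comp h (comp g f) = comp (comp h g) f }.

Arguments hom {c} A B.
Arguments idm {c} A.
Arguments comp {c A B C} g f.
Notation "g ∘ f" := (comp g f) (at level 40, left associativity).

(* Equality of arrows whose endpoints are equal objects, but possibly not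
   convertible ones.  This is how equations involving the identifications
   A ⊗ (B ⊗ C) = (A ⊗ B) ⊗ C and I ⊗ A = A = A ⊗ I of a strict monoidal
   category are written; between parallel arrows it is plain equality
   (heq_eq). *)
Inductive heq (C : category) (A B : C) (f : hom A B) :
  forall A' B' : C, hom A' B' -> Prop := heq_refl : heq f f.
Notation "f ≡ g" := (heq f g) (at level 70, no associativity).

Record functor (C D : category) := Functor {
  fob :> C -> D;
  fmap : forall A B : C, hom A B -> hom (fob A) (fob B);
  fmap1 : forall A : C, fmap (idm A) = idm (fob A);
  fmapM : forall (A B E : C) (g : hom B E) (f : hom A B),
    fmap (g ∘ f) = fmap g ∘ fmap f }.
Arguments fmap {C D} f {A B} _ : rename.

(* Functors C^op -> D. *)
Record contrafunctor (C D : category) := Contrafunctor {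
  cob :> C -> D;
  cmap : forall A B : C, hom A B -> hom (cob B) (cob A);
  cmap1 : forall A : C, cmap (idm A) = idm (cob A);
  cmapM : forall (A B E : C) (g : hom B E) (f : hom A B),
    cmap (g ∘ f) = cmap f ∘ cmap g }.
Arguments cmap {C D} c {A B} _ : rename.

Record strict_monoidal (C : category) := Monoidal {
  tens : C -> C -> C;
  unit : C;
  tensm : forall A B A' B' : C,
    hom A B -> hom A' B' -> hom (tens A A') (tens B B');
  tensm1 : forall A B : C, tensm (idm A) (idm B) = idm (tens A B);
  tensmM : forall (A B E A' B' E' : C)
      (g : hom B E) (f : hom A B) (g' : hom B' E') (f' : hom A' B'),
    tensm (g ∘ f) (g' ∘ f') = tensm g g' ∘ tensm f f';
  tensA : forall A B E : C, tens A (tens B E) = tens (tens A B) E;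
  tens1o : forall A : C, tens unit A = A;
  tenso1 : forall A : C, tens A unit = A;
  tensmA : forall (A B A' B' A'' B'' : C)
      (f : hom A B) (g : hom A' B') (h : hom A'' B''),
    tensm f (tensm g h) ≡ tensm (tensm f g) h;
  tens1m : forall (A B : C) (f : hom A B), tensm (idm unit) f ≡ f;
  tensm1r : forall (A B : C) (f : hom A B), tensm f (idm unit) ≡ f }.
Arguments tensm {C} m {A B A' B'} _ _ : rename.

(* Linear distributions; the arguments of [ld_dr] are in the order in which
   they occur in its domain. *)
Record linear_distributions (C : category) (star dia : strict_monoidal C) :=
  LinearDistributions {
  ld_dl : forall A B E : C,
    hom (tens star A (tens dia B E)) (tens dia (tens star A B) E);
  ld_dr : forall A B E : C,
    hom (tens star (tens dia A B) E) (tens dia A (tens star B E));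
  ld_dl_nat : forall (A A' B B' E E' : C)
      (f : hom A A') (g : hom B B') (h : hom E E'),
    ld_dl A' B' E' ∘ tensm star f (tensm dia g h)
    = tensm dia (tensm star f g) h ∘ ld_dl A B E;
  ld_dr_nat : forall (A A' B B' E E' : C)
      (f : hom A A') (g : hom B B') (h : hom E E'),
    ld_dr A' B' E' ∘ tensm star (tensm dia f g) h
    = tensm dia f (tensm star g h) ∘ ld_dr A B E;
  ld_dl_I : forall B E : C, ld_dl (unit star) B E ≡ idm (tens dia B E);
  ld_dl_J : forall A B : C, ld_dl A B (unit dia) ≡ idm (tens star A B);
  ld_dr_I : forall A B : C, ld_dr A B (unit star) ≡ idm (tens dia A B);
  ld_dr_J : forall B E : C, ld_dr (unit dia) B E ≡ idm (tens star B E);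
  (* A ⋆ B ⋆ (E ⋄ F) -> (A ⋆ B ⋆ E) ⋄ F *)
  ld_dl_star : forall A B E F : C,
    ld_dl (tens star A B) E F
    ≡ ld_dl A (tens star B E) F ∘ tensm star (idm A) (ld_dl B E F);
  (* A ⋆ (B ⋄ E ⋄ F) -> (A ⋆ B) ⋄ E ⋄ F *)
  ld_dl_dia : forall A B E F : C,
    ld_dl A B (tens dia E F)
    ≡ tensm dia (ld_dl A B E) (idm F) ∘ ld_dl A (tens dia B E) F;
  (* (A ⋄ B) ⋆ E ⋆ F -> A ⋄ (B ⋆ E ⋆ F) *)
  ld_dr_star : forall A B E F : C,
    ld_dr A B (tens star E F)
    ≡ ld_dr A (tens star B E) F ∘ tensm star (ld_dr A B E) (idm F);
  (* (A ⋄ B ⋄ E) ⋆ F -> A ⋄ B ⋄ (E ⋆ F) *)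
  ld_dr_dia : forall A B E F : C,
    ld_dr (tens dia A B) E F
    ≡ tensm dia (idm A) (ld_dr B E F) ∘ ld_dr A (tens dia B E) F;
  (* A ⋆ (B ⋄ E) ⋆ F -> (A ⋆ B) ⋄ (E ⋆ F) *)
  ld_dlr_star : forall A B E F : C,
    ld_dr (tens star A B) E F ∘ tensm star (ld_dl A B E) (idm F)
    ≡ ld_dl A B (tens star E F) ∘ tensm star (idm A) (ld_dr B E F);
  (* (A ⋄ B) ⋆ (E ⋄ F) -> A ⋄ (B ⋆ E) ⋄ F *)
  ld_dlr_dia : forall A B E F : C,
    tensm dia (ld_dr A B E) (idm F) ∘ ld_dl (tens dia A B) E F
    ≡ tensm dia (idm A) (ld_dl B E F) ∘ ld_dr A B (tens dia E F) }.

Record lin_dist_cat := LinDistCat {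
  ld_cat :> category;
  ld_star : strict_monoidal ld_cat;
  ld_dia : strict_monoidal ld_cat;
  ld_dist : linear_distributions ld_star ld_dia }.

Arguments ld_star {l}.
Arguments ld_dia {l}.
Notation "A ⋆ B" := (tens ld_star A B) (at level 38, left associativity).
Notation "A ⋄ B" := (tens ld_dia A B) (at level 38, left associativity).
Notation "f [⋆] g" := (tensm ld_star f g) (at level 38, left associativity).
Notation "f [⋄] g" := (tensm ld_dia f g) (at level 38, left associativity).
Notation "'I_⋆'" := (unit ld_star).
Notation "'J_⋄'" := (unit ld_dia).

Definition dl (L : lin_dist_cat) (A B E : L) :
  hom (A ⋆ (B ⋄ E)) ((A ⋆ B) ⋄ E) := ld_dl (ld_dist L) A B E.
Definition dr (L : lin_dist_cat) (A B E : L) :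
  hom ((A ⋄ B) ⋆ E) (A ⋄ (B ⋆ E)) := ld_dr (ld_dist L) A B E.

Record negations (L : lin_dist_cat) (S S' : contrafunctor L L) := Negations {
  ev : forall A : L, hom (S A ⋆ A) J_⋄;
  ev' : forall A : L, hom (A ⋆ S' A) J_⋄;
  coev : forall A : L, hom I_⋆ (A ⋄ S A);
  coev' : forall A : L, hom I_⋆ (S' A ⋄ A);
  ev_dinat : forall (A B : L) (f : hom A B),
    ev A ∘ (cmap S f [⋆] idm A) = ev B ∘ (idm (S B) [⋆] f);
  ev'_dinat : forall (A B : L) (f : hom A B),
    ev' A ∘ (idm A [⋆] cmap S' f) = ev' B ∘ (f [⋆] idm (S' B));
  coev_dinat : forall (A B : L) (f : hom A B),
    (f [⋄] idm (S A)) ∘ coev A = (idm B [⋄] cmap S f) ∘ coev B;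
  coev'_dinat : forall (A B : L) (f : hom A B),
    (idm (S' A) [⋄] f) ∘ coev' A = (cmap S' f [⋄] idm B) ∘ coev' B;
  triangle_l : forall A : L,
    (idm A [⋄] ev A) ∘ dr A (S A) A ∘ (coev A [⋆] idm A) ≡ idm A;
  triangle_r : forall A : L,
    (ev A [⋄] idm (S A)) ∘ dl (S A) A (S A) ∘ (idm (S A) [⋆] coev A)
    ≡ idm (S A);
  triangle'_l : forall A : L,
    (ev' A [⋄] idm A) ∘ dl A (S' A) A ∘ (idm A [⋆] coev' A) ≡ idm A;
  triangle'_r : forall A : L,
    (idm (S' A) [⋄] ev' A) ∘ dr (S' A) A (S' A) ∘ (coev' A [⋆] idm (S' A))
    ≡ idm (S' A) }.

Record comonad (C : category) := Comonad {
  cm_fun :> functor C C;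
  delta : forall A : C, hom (cm_fun A) (cm_fun (cm_fun A));
  eps : forall A : C, hom (cm_fun A) A;
  delta_nat : forall (A B : C) (f : hom A B),
    delta B ∘ fmap cm_fun f = fmap cm_fun (fmap cm_fun f) ∘ delta A;
  eps_nat : forall (A B : C) (f : hom A B),
    eps B ∘ fmap cm_fun f = f ∘ eps A;
  eps_delta : forall A : C, eps (cm_fun A) ∘ delta A = idm (cm_fun A);
  fmap_eps_delta : forall A : C,
    fmap cm_fun (eps A) ∘ delta A = idm (cm_fun A);
  delta_delta : forall A : C,
    delta (cm_fun A) ∘ delta A = fmap cm_fun (delta A) ∘ delta A }.
Arguments delta {C} c A.
Arguments eps {C} c A.

Record lax_monoidal (C : category) (M : strict_monoidal C) (G : functor C C) :=
  LaxMonoidal {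
  mu : forall A B : C, hom (tens M (G A) (G B)) (G (tens M A B));
  mu0 : hom (unit M) (G (unit M));
  mu_nat : forall (A A' B B' : C) (f : hom A A') (g : hom B B'),
    mu A' B' ∘ tensm M (fmap G f) (fmap G g) = fmap G (tensm M f g) ∘ mu A B;
  mu_assoc : forall A B E : C,
    mu A (tens M B E) ∘ tensm M (idm (G A)) (mu B E)
    ≡ mu (tens M A B) E ∘ tensm M (mu A B) (idm (G E));
  mu_unitl : forall A : C,
    mu (unit M) A ∘ tensm M mu0 (idm (G A)) ≡ idm (G A);
  mu_unitr : forall A : C,
    mu A (unit M) ∘ tensm M (idm (G A)) mu0 ≡ idm (G A) }.
Arguments mu {C M G} l A B.
Arguments mu0 {C M G} l.

Record monoidal_comonad (C : category) (M : strict_monoidal C) (G : comonad C) :=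
  MonoidalComonad {
  mc_lax :> lax_monoidal M G;
  delta_mu : forall A B : C,
    delta G (tens M A B) ∘ mu mc_lax A B
    = fmap G (mu mc_lax A B) ∘ mu mc_lax (G A) (G B)
      ∘ tensm M (delta G A) (delta G B);
  delta_mu0 : delta G (unit M) ∘ mu0 mc_lax = fmap G (mu0 mc_lax) ∘ mu0 mc_lax;
  eps_mu : forall A B : C,
    eps G (tens M A B) ∘ mu mc_lax A B = tensm M (eps G A) (eps G B);
  eps_mu0 : eps G (unit M) ∘ mu0 mc_lax = idm (unit M) }.

Record coalgebra (C : category) (G : comonad C) := Coalgebra {
  carrier :> C;
  coact : hom carrier (G carrier);
  coact_eps : eps G carrier ∘ coact = idm carrier;
  coact_delta : delta G carrier ∘ coact = fmap G coact ∘ coact }.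

Record coalgebra_hom (C : category) (G : comonad C) (X Y : coalgebra G) :=
  CoalgebraHom {
  under :> hom (carrier X) (carrier Y);
  underP : fmap G under ∘ coact X = coact Y ∘ under }.

Arguments CoalgebraHom {C G} X Y _ _.

Section Equality.
Variable C : category.

Lemma heq_dom (A B A' B' : C) (f : hom A B) (g : hom A' B') : f ≡ g -> A = A'.
Proof. by case. Qed.

Lemma heq_cod (A B A' B' : C) (f : hom A B) (g : hom A' B') : f ≡ g -> B = B'.
Proof. by case. Qed.

Lemma heq_sig (A B A' B' : C) (f : hom A B) (g : hom A' B') : f ≡ g ->
  existT (fun A => {B : C & hom A B}) A (existT _ B f)
  = existT (fun A => {B : C & hom A B}) A' (existT _ B' g).
Proof. by case. Qed.

Lemma heq_eq (A B : C) (f g : hom A B) : f ≡ g -> f = g.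
Proof. by move=> /heq_sig H; move: (inj_pair2 _ _ _ _ _ H); apply: inj_pair2. Qed.

Lemma eq_heq (A B : C) (f g : hom A B) : f = g -> f ≡ g.
Proof. by move=> ->. Qed.

Lemma heq_sym (A B A' B' : C) (f : hom A B) (g : hom A' B') : f ≡ g -> g ≡ f.
Proof. by case. Qed.

Lemma heq_trans (A B A' B' A'' B'' : C)
    (f : hom A B) (g : hom A' B') (h : hom A'' B'') :
  f ≡ g -> g ≡ h -> f ≡ h.
Proof. by move=> fg; case. Qed.

Lemma heq_comp (A B E A' B' E' : C) (g : hom B E) (f : hom A B)
    (g' : hom B' E') (f' : hom A' B') :
  g ≡ g' -> f ≡ f' -> g ∘ f ≡ g' ∘ f'.
Proof.
move=> Hg Hf; move: (heq_dom Hf) (heq_cod Hf) (heq_cod Hg) => eA eB eE.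
by subst A' B' E'; rewrite (heq_eq Hg) (heq_eq Hf).
Qed.

Lemma heq_fmap (F : functor C C) (A B A' B' : C) (f : hom A B)
  (g : hom A' B') : f ≡ g -> fmap F f ≡ fmap F g.
Proof. by case. Qed.

Lemma heq_idm (A B : C) : A = B -> idm A ≡ idm B.
Proof. by move=> ->. Qed.

End Equality.

Section EilenbergMoore.
Variables (C : category) (G : comonad C).

Lemma coalgebra_hom_eq (X Y : coalgebra G) (f g : coalgebra_hom X Y) :
  under f = under g -> f = g.
Proof.
case: f g => f Hf [g Hg] /= fg; subst g.
by rewrite (proof_irrelevance _ Hf Hg).
Qed.

Lemma coalgebra_eq (X Y : coalgebra G) : coact X ≡ coact Y -> X = Y.
Proof.
case: X Y => A a a1 a2 [B b b1 b2] /= H.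
move: (heq_dom H) => eA; subst B; move: (heq_eq H) => eA; subst b.
by rewrite (proof_irrelevance _ a1 b1) (proof_irrelevance _ a2 b2).
Qed.

Lemma em_id_proof (X : coalgebra G) :
  fmap G (idm (carrier X)) ∘ coact X = coact X ∘ idm (carrier X).
Proof. by rewrite fmap1 comp1m compm1. Qed.

Definition em_id (X : coalgebra G) : coalgebra_hom X X :=
  CoalgebraHom X X _ (em_id_proof X).

Lemma em_comp_proof (X Y Z : coalgebra G)
    (g : coalgebra_hom Y Z) (f : coalgebra_hom X Y) :
  fmap G (under g ∘ under f) ∘ coact X = coact Z ∘ (under g ∘ under f).
Proof. by rewrite fmapM -compA underP compA underP compA. Qed.

Definition em_comp (X Y Z : coalgebra G)
    (g : coalgebra_hom Y Z) (f : coalgebra_hom X Y) : coalgebra_hom X Z :=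
  CoalgebraHom X Z _ (em_comp_proof g f).

(* The category C^G. *)
Definition em : category.
Proof.
refine (@Category (coalgebra G) (@coalgebra_hom C G) em_id em_comp _ _ _).
- by move=> A B f; apply: coalgebra_hom_eq; apply: comp1m.
- by move=> A B f; apply: coalgebra_hom_eq; apply: compm1.
- by move=> A B E D h g f; apply: coalgebra_hom_eq; apply: compA.
Defined.

Lemma em_heq (X Y X' Y' : em) (f : hom X Y) (g : hom X' Y') :
  X = X' -> Y = Y' -> under f ≡ under g -> f ≡ g.
Proof.
move=> eX eY; subst X' Y' => /heq_eq /coalgebra_hom_eq ->; exact: heq_refl.
Qed.

Section Monoidal.
Variables (M : strict_monoidal C) (Phi : monoidal_comonad M G).

Lemma heq_tensm (A B A' B' E F E' F' : C) (f : hom A B) (g : hom A' B')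
    (h : hom E F) (k : hom E' F') :
  f ≡ g -> h ≡ k -> tensm M f h ≡ tensm M g k.
Proof. by case; case. Qed.

Definition em_tens_coact (X Y : coalgebra G) :
    hom (tens M X Y) (G (tens M X Y)) :=
  mu Phi X Y ∘ tensm M (coact X) (coact Y).

Lemma em_tens_eps (X Y : coalgebra G) :
  eps G (tens M X Y) ∘ em_tens_coact X Y = idm (tens M X Y).
Proof.
by rewrite /em_tens_coact compA eps_mu -tensmM !coact_eps tensm1.
Qed.

Lemma em_tens_delta (X Y : coalgebra G) :
  delta G (tens M X Y) ∘ em_tens_coact X Y
  = fmap G (em_tens_coact X Y) ∘ em_tens_coact X Y.
Proof.
rewrite /em_tens_coact compA delta_mu -compA -tensmM !coact_delta tensmM.
by rewrite fmapM !compA -(compA (fmap G (mu Phi X Y))) mu_nat !compA.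
Qed.

Definition em_tens (X Y : coalgebra G) : coalgebra G :=
  Coalgebra (em_tens_eps X Y) (em_tens_delta X Y).

Definition em_unit : coalgebra G := Coalgebra (eps_mu0 Phi) (delta_mu0 Phi).

Lemma em_tensm_proof (X Y X' Y' : coalgebra G)
    (f : coalgebra_hom X Y) (g : coalgebra_hom X' Y') :
  fmap G (tensm M (under f) (under g)) ∘ coact (em_tens X X')
  = coact (em_tens Y Y') ∘ tensm M (under f) (under g).
Proof.
rewrite /= /em_tens_coact compA -mu_nat -!compA -!tensmM.
by rewrite !underP.
Qed.

Definition em_tensm (X Y X' Y' : coalgebra G)
    (f : coalgebra_hom X Y) (g : coalgebra_hom X' Y') :
    coalgebra_hom (em_tens X X') (em_tens Y Y') :=
  CoalgebraHom (em_tens X X') (em_tens Y Y') _ (em_tensm_proof f g).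

Lemma em_tensA (X Y Z : coalgebra G) :
  em_tens X (em_tens Y Z) = em_tens (em_tens X Y) Z.
Proof.
apply: coalgebra_eq; rewrite /= /em_tens_coact /=.
rewrite -{1}(comp1m (coact X)) tensmM compA.
rewrite -{2}(comp1m (coact Z)) tensmM compA.
apply: heq_comp; [exact: mu_assoc | exact: tensmA].
Qed.

Lemma em_tens1o (X : coalgebra G) : em_tens em_unit X = X.
Proof.
apply: coalgebra_eq; rewrite /= /em_tens_coact /=.
rewrite -{1}(comp1m (coact X)) -(compm1 (mu0 Phi)) tensmM compA.
apply: (heq_trans (g := idm (G X) ∘ coact X)); last first.
  by rewrite comp1m; exact: heq_refl.
apply: heq_comp; [exact: mu_unitl | exact: tens1m].
Qed.

Lemma em_tenso1 (X : coalgebra G) : em_tens X em_unit = X.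
Proof.
apply: coalgebra_eq; rewrite /= /em_tens_coact /=.
rewrite -{1}(comp1m (coact X)) -(compm1 (mu0 Phi)) tensmM compA.
apply: (heq_trans (g := idm (G X) ∘ coact X)); last first.
  by rewrite comp1m; exact: heq_refl.
apply: heq_comp; [exact: mu_unitr | exact: tensm1r].
Qed.

Definition em_monoidal : strict_monoidal em.
Proof.
refine (@Monoidal em em_tens em_unit em_tensm _ _
          em_tensA em_tens1o em_tenso1 _ _ _).
- by move=> A B; apply: coalgebra_hom_eq; apply: tensm1.
- by move=> *; apply: coalgebra_hom_eq; apply: tensmM.
- by move=> *; apply: em_heq; [exact: em_tensA | exact: em_tensA | exact: tensmA].
- by move=> *; apply: em_heq; [exact: em_tens1o | exact: em_tens1o | exact: tens1m].
- by move=> *; apply: em_heq; [exact: em_tenso1 | exact: em_tenso1 | exact: tensm1r].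
Defined.

End Monoidal.

Record lifting (S : contrafunctor C C) := Lifting {
  nu :> forall A : C, hom (S A) (G (S (G A)));
  nu_nat : forall (A B : C) (f : hom A B),
    nu A ∘ cmap S f = fmap G (cmap S (fmap G f)) ∘ nu B;
  nu_eps : forall A : C, eps G (S (G A)) ∘ nu A = cmap S (eps G A);
  nu_delta : forall A : C,
    delta G (S (G A)) ∘ nu A
    = fmap G (fmap G (cmap S (delta G A))) ∘ fmap G (nu (G A)) ∘ nu A }.

Section Lift.
Variables (S : contrafunctor C C) (v : lifting S).

Definition lift_coact (X : coalgebra G) : hom (S X) (G (S X)) :=
  fmap G (cmap S (coact X)) ∘ v X.

Lemma lift_coact_eps (X : coalgebra G) :
  eps G (S X) ∘ lift_coact X = idm (S X).
Proof.
by rewrite /lift_coact compA eps_nat -compA nu_eps -cmapM coact_eps cmap1.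
Qed.

Lemma lift_coact_delta (X : coalgebra G) :
  delta G (S X) ∘ lift_coact X = fmap G (lift_coact X) ∘ lift_coact X.
Proof.
rewrite /lift_coact compA delta_nat -compA nu_delta.
have H : fmap G (cmap S (coact X)) ∘ fmap G (cmap S (delta G X)) ∘ v (G X)
       = fmap G (cmap S (coact X)) ∘ v X ∘ cmap S (coact X).
  by rewrite -fmapM -cmapM coact_delta cmapM fmapM -!compA nu_nat.
by rewrite !compA -2!(fmapM G) H !fmapM.
Qed.

Definition lift_ob (X : coalgebra G) : coalgebra G :=
  Coalgebra (lift_coact_eps X) (lift_coact_delta X).

Lemma lift_hom_proof (X Y : coalgebra G) (f : coalgebra_hom X Y) :
  fmap G (cmap S (under f)) ∘ coact (lift_ob Y)
  = coact (lift_ob X) ∘ cmap S (under f).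
Proof.
rewrite /= /lift_coact -compA nu_nat !compA -!fmapM -!cmapM.
by rewrite underP.
Qed.

Definition lift_hom (X Y : coalgebra G) (f : coalgebra_hom X Y) :
    coalgebra_hom (lift_ob Y) (lift_ob X) :=
  CoalgebraHom (lift_ob Y) (lift_ob X) _ (lift_hom_proof f).

Definition lift : contrafunctor em em.
Proof.
refine (@Contrafunctor em em lift_ob lift_hom _ _).
- by move=> A; apply: coalgebra_hom_eq; apply: cmap1.
- by move=> *; apply: coalgebra_hom_eq; apply: cmapM.
Defined.

End Lift.
End EilenbergMoore.

Section EilenbergMooreLinDist.
Variables (L : lin_dist_cat) (G : comonad L).
Variables (Phi : monoidal_comonad ld_star G) (Psi : monoidal_comonad ld_dia G).

Definition dl_compatible : Prop := forall A B E : coalgebra G,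
  fmap G (dl A B E) ∘ mu Phi A (B ⋄ E) ∘ (idm (G A) [⋆] mu Psi B E)
  = mu Psi (A ⋆ B) E ∘ (mu Phi A B [⋄] idm (G E)) ∘ dl (G A) (G B) (G E).

Definition dr_compatible : Prop := forall A B E : coalgebra G,
  fmap G (dr B E A) ∘ mu Phi (B ⋄ E) A ∘ (mu Psi B E [⋆] idm (G A))
  = mu Psi B (E ⋆ A) ∘ (idm (G B) [⋄] mu Phi E A) ∘ dr (G B) (G E) (G A).

Hypotheses (Hl : dl_compatible) (Hr : dr_compatible).

Lemma em_dl_proof (X Y Z : coalgebra G) :
  fmap G (dl X Y Z) ∘ coact (em_tens Phi X (em_tens Psi Y Z))
  = coact (em_tens Psi (em_tens Phi X Y) Z) ∘ dl X Y Z.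
Proof.
rewrite /= /em_tens_coact /= /em_tens_coact.
rewrite -{1}(comp1m (coact X)) tensmM !compA Hl.
rewrite -{2}(comp1m (coact Z)) tensmM !compA -!compA.
by rewrite /dl ld_dl_nat.
Qed.

Lemma em_dr_proof (X Y Z : coalgebra G) :
  fmap G (dr X Y Z) ∘ coact (em_tens Phi (em_tens Psi X Y) Z)
  = coact (em_tens Psi X (em_tens Phi Y Z)) ∘ dr X Y Z.
Proof.
rewrite /= /em_tens_coact /= /em_tens_coact.
rewrite -{1}(comp1m (coact Z)) tensmM !compA Hr.
rewrite -{2}(comp1m (coact X)) tensmM !compA -!compA.
by rewrite /dr ld_dr_nat.
Qed.

Definition em_dl (X Y Z : coalgebra G) : coalgebra_hom
    (em_tens Phi X (em_tens Psi Y Z)) (em_tens Psi (em_tens Phi X Y) Z) :=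
  CoalgebraHom (em_tens Phi X (em_tens Psi Y Z))
    (em_tens Psi (em_tens Phi X Y) Z) _ (em_dl_proof X Y Z).

Definition em_dr (X Y Z : coalgebra G) : coalgebra_hom
    (em_tens Phi (em_tens Psi X Y) Z) (em_tens Psi X (em_tens Phi Y Z)) :=
  CoalgebraHom (em_tens Phi (em_tens Psi X Y) Z)
    (em_tens Psi X (em_tens Phi Y Z)) _ (em_dr_proof X Y Z).

Definition em_lin_dist : linear_distributions (em_monoidal Phi) (em_monoidal Psi).
Proof.
refine (@LinearDistributions (em G) (em_monoidal Phi) (em_monoidal Psi)
           em_dl em_dr _ _ _ _ _ _ _ _ _ _ _ _) => /=.
1, 2: move=> *; apply: coalgebra_hom_eq.
3-12: move=> *; apply: em_heq; try by rewrite ?em_tensA ?em_tens1o ?em_tenso1.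
- exact: ld_dl_nat.
- exact: ld_dr_nat.
- exact: (ld_dl_I (ld_dist L)).
- exact: (ld_dl_J (ld_dist L)).
- exact: (ld_dr_I (ld_dist L)).
- exact: (ld_dr_J (ld_dist L)).
- exact: (ld_dl_star (ld_dist L)).
- exact: (ld_dl_dia (ld_dist L)).
- exact: (ld_dr_star (ld_dist L)).
- exact: (ld_dr_dia (ld_dist L)).
- exact: (ld_dlr_star (ld_dist L)).
- exact: (ld_dlr_dia (ld_dist L)).
Defined.

Definition em_ld : lin_dist_cat := LinDistCat em_lin_dist.

End EilenbergMooreLinDist.

(* Main.v *)
From Corelib Require Import ssreflect.
Require Import Defs.

Set Implicit Arguments.
Unset Strict Implicit.
Unset Printing Implicit Defensive.

(** Dinaturality of the evaluations and coevaluations and the triangle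
    identities hold in the category of coalgebras as soon as they hold in [L]:
    the forgetful functor is faithful, and the identifications of objects
    needed to state the triangles also hold between coalgebras.  Condition (ii)
    of the proposition therefore only says that the four morphisms attached to
    each coalgebra are coalgebra morphisms, and each of the four equations in
    condition (i) is equivalent to one of these four assertions
    ([ev_coalgebra_hom], [coev_coalgebra_hom] and their mirror images).

    Let [γ] be the coaction of a coalgebra [A].  From (i) to (ii), for the
    evaluation: compose the equation at [A] with [1 ⋆ γ] on the right, use
    [ε γ = 1] and [δ γ = Gγ γ], and move [γ] to the other factor by
    dinaturality.  For the coevaluation: compose the equation with
    [G(1 ⋄ Sγ)] on the left instead.  From (ii) to (i), the equations at an
    arbitrary object [A] are obtained from the cofree coalgebra [(G A, δ)], by
    composing the condition that its evaluation is a coalgebra morphism with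
    [Sε ⋆ 1] on the right, and the one for its coevaluation with [G(ε ⋄ 1)] on
    the left. *)

(** The cofree coalgebra on an object. *)
Definition cofree (C : category) (G : comonad C) (A : C) : coalgebra G :=
  Coalgebra (eps_delta G A) (delta_delta G A).

(** The condition, property [underP] of [coalgebra_hom], that an arrow between
    the carriers of two coalgebras is a coalgebra morphism. *)
Definition is_coalgebra_hom (C : category) (G : comonad C) (X Y : coalgebra G)
    (f : hom (carrier X) (carrier Y)) : Prop :=
  fmap G f ∘ coact X = coact Y ∘ f.
Arguments is_coalgebra_hom {C G} X Y f.

Section TensorArrows.
Variables (C : category) (M : strict_monoidal C).

Lemma tensm_idl (A B D E : C) (g : hom B D) (f : hom A B) :
  tensm M (idm E) (g ∘ f) = tensm M (idm E) g ∘ tensm M (idm E) f.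
Proof. by rewrite -tensmM comp1m. Qed.

Lemma tensm_idr (A B D E : C) (g : hom B D) (f : hom A B) :
  tensm M (g ∘ f) (idm E) = tensm M g (idm E) ∘ tensm M f (idm E).
Proof. by rewrite -tensmM comp1m. Qed.

Lemma tensm_lr (A B A' B' : C) (f : hom A B) (g : hom A' B') :
  tensm M f g = tensm M f (idm B') ∘ tensm M (idm A) g.
Proof. by rewrite -tensmM compm1 comp1m. Qed.

Lemma tensm_rl (A B A' B' : C) (f : hom A B) (g : hom A' B') :
  tensm M f g = tensm M (idm B) g ∘ tensm M f (idm A').
Proof. by rewrite -tensmM compm1 comp1m. Qed.

Variables (G : functor C C) (Phi : lax_monoidal M G).

Lemma mu_nat_l (A A' B : C) (f : hom A A') :
  mu Phi A' B ∘ tensm M (fmap G f) (idm (G B))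
  = fmap G (tensm M f (idm B)) ∘ mu Phi A B.
Proof. by rewrite -mu_nat fmap1. Qed.

Lemma mu_nat_r (A B B' : C) (f : hom B B') :
  mu Phi A B' ∘ tensm M (idm (G A)) (fmap G f)
  = fmap G (tensm M (idm A) f) ∘ mu Phi A B.
Proof. by rewrite -mu_nat fmap1. Qed.

End TensorArrows.

(** The transformation [ν] is recovered from the coactions it induces on the
    lifts of cofree coalgebras. *)
Lemma lift_coact_cofree (C : category) (G : comonad C)
    (S : contrafunctor C C) (v : lifting G S) (A : C) :
  lift_coact v (cofree G A) ∘ cmap S (eps G A) = v A.
Proof.
rewrite /lift_coact /= -compA nu_nat compA -fmapM -cmapM fmap_eps_delta.
by rewrite cmap1 fmap1 comp1m.
Qed.

(** Coassociativity of the coaction, transported through the lifting. *)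
Lemma lift_coact_cmap (C : category) (G : comonad C)
    (S : contrafunctor C C) (v : lifting G S) (X : coalgebra G) :
  lift_coact v X ∘ cmap S (coact X)
  = fmap G (cmap S (delta G X ∘ coact X)) ∘ v (G X).
Proof.
by rewrite /lift_coact -compA nu_nat compA -fmapM -cmapM coact_delta.
Qed.

Section CoalgebraMorphisms.
Variables (L : lin_dist_cat) (S S' : contrafunctor L L) (N : negations S S').
Variables (G : comonad L).
Variables (Phi : monoidal_comonad ld_star G) (Psi : monoidal_comonad ld_dia G).

Lemma ev_coalgebra_hom (v : lifting G S) :
  (forall A : L,
    mu0 Psi ∘ ev N A ∘ (idm (S A) [⋆] eps G A)
    = fmap G (ev N (G A)) ∘ mu Phi (S (G A)) (G A) ∘ (v A [⋆] delta G A))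
  <-> forall X : coalgebra G,
    is_coalgebra_hom (em_tens Phi (lift_ob v X) X)
      (em_unit Psi) (ev N X).
Proof.
split=> [H X | H A].
- have := f_equal (fun h => h ∘ (idm (S X) [⋆] coact X)) (H X).
  rewrite -!compA -!tensmM coact_eps !compm1 tensm1 compm1 coact_delta.
  rewrite /is_coalgebra_hom /= /em_tens_coact /= /lift_coact => ->.
  rewrite -{2}(comp1m (v X)) tensmM (compA (mu Phi _ _)) mu_nat_r.
  rewrite !compA -fmapM -ev_dinat fmapM -(compA _ _ (mu Phi _ _)) -mu_nat_l.
  by rewrite -!compA -tensmM comp1m.
- have := f_equal (fun h => h ∘ (cmap S (eps G A) [⋆] idm (G A)))
                  (H (cofree G A)).
  rewrite /= /em_tens_coact /= -!compA -tensmM compm1 lift_coact_cofree.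
  by rewrite ev_dinat => ->.
Qed.

Lemma ev'_coalgebra_hom (v : lifting G S') :
  (forall A : L,
    mu0 Psi ∘ ev' N A ∘ (eps G A [⋆] idm (S' A))
    = fmap G (ev' N (G A)) ∘ mu Phi (G A) (S' (G A)) ∘ (delta G A [⋆] v A))
  <-> forall X : coalgebra G,
    is_coalgebra_hom (em_tens Phi X (lift_ob v X))
      (em_unit Psi) (ev' N X).
Proof.
split=> [H X | H A].
- have := f_equal (fun h => h ∘ (coact X [⋆] idm (S' X))) (H X).
  rewrite -!compA -!tensmM coact_eps !compm1 tensm1 compm1 coact_delta.
  rewrite /is_coalgebra_hom /= /em_tens_coact /= /lift_coact => ->.
  rewrite -{2}(comp1m (v X)) tensmM (compA (mu Phi _ _)) mu_nat_l.
  rewrite !compA -fmapM -ev'_dinat fmapM -(compA _ _ (mu Phi _ _)) -mu_nat_r.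
  by rewrite -!compA -tensmM comp1m.
- have := f_equal (fun h => h ∘ (idm (G A) [⋆] cmap S' (eps G A)))
                  (H (cofree G A)).
  rewrite /= /em_tens_coact /= -!compA -tensmM compm1 lift_coact_cofree.
  by rewrite ev'_dinat => ->.
Qed.

Lemma coev_coalgebra_hom (v : lifting G S) :
  (forall A : L,
    fmap G (idm A [⋄] cmap S (eps G A)) ∘ fmap G (coev N A) ∘ mu0 Phi
    = fmap G (idm A [⋄] cmap S (delta G A)) ∘ mu Psi A (S (G (G A)))
      ∘ (idm (G A) [⋄] v (G A)) ∘ coev N (G A))
  <-> forall X : coalgebra G,
    is_coalgebra_hom (em_unit Phi)
      (em_tens Psi X (lift_ob v X)) (coev N X).
Proof.
split=> [H X | H A].
- have := f_equal (fun h => fmap G (idm (carrier X) [⋄] cmap S (coact X)) ∘ h)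
                  (H X).
  rewrite !compA -!fmapM -tensm_idl -cmapM coact_eps cmap1 tensm1 comp1m.
  rewrite /is_coalgebra_hom /= /em_tens_coact /= => ->.
  rewrite [in RHS]tensm_rl -!compA coev_dinat.
  rewrite [in RHS](compA _ _ (coev N _)) -[in RHS]tensm_idl.
  rewrite lift_coact_cmap [in RHS]tensm_idl !compA mu_nat_r.
  by rewrite -tensm_idl -cmapM.
- have := f_equal (fun h => fmap G (eps G A [⋄] idm (S (G A))) ∘ h)
                  (H (cofree G A)).
  rewrite /= /em_tens_coact /= /lift_coact /= !compA -!fmapM coev_dinat => ->.
  rewrite -mu_nat -(compA (mu Psi _ _)) -tensmM fmap_eps_delta fmap1 comp1m.
  by rewrite tensm_idl !compA mu_nat_r.
Qed.

Lemma coev'_coalgebra_hom (v : lifting G S') :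
  (forall A : L,
    fmap G (cmap S' (eps G A) [⋄] idm A) ∘ fmap G (coev' N A) ∘ mu0 Phi
    = fmap G (cmap S' (delta G A) [⋄] idm A) ∘ mu Psi (S' (G (G A))) A
      ∘ (v (G A) [⋄] idm (G A)) ∘ coev' N (G A))
  <-> forall X : coalgebra G,
    is_coalgebra_hom (em_unit Phi)
      (em_tens Psi (lift_ob v X) X) (coev' N X).
Proof.
split=> [H X | H A].
- have := f_equal (fun h => fmap G (cmap S' (coact X) [⋄] idm (carrier X)) ∘ h)
                  (H X).
  rewrite !compA -!fmapM -tensm_idr -cmapM coact_eps cmap1 tensm1 comp1m.
  rewrite /is_coalgebra_hom /= /em_tens_coact /= => ->.
  rewrite [in RHS]tensm_lr -!compA coev'_dinat.
  rewrite [in RHS](compA _ _ (coev' N _)) -[in RHS]tensm_idr.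
  rewrite lift_coact_cmap [in RHS]tensm_idr !compA mu_nat_l.
  by rewrite -tensm_idr -cmapM.
- have := f_equal (fun h => fmap G (idm (S' (G A)) [⋄] eps G A) ∘ h)
                  (H (cofree G A)).
  rewrite /= /em_tens_coact /= /lift_coact /= !compA -!fmapM coev'_dinat => ->.
  rewrite -mu_nat -(compA (mu Psi _ _)) -tensmM fmap_eps_delta fmap1 comp1m.
  by rewrite tensm_idr !compA mu_nat_l.
Qed.

End CoalgebraMorphisms.

Section LiftedNegations.
Variables (L : lin_dist_cat) (S S' : contrafunctor L L) (N : negations S S').
Variables (G : comonad L).
Variables (Phi : monoidal_comonad ld_star G) (Psi : monoidal_comonad ld_dia G).
Variables (Hl : dl_compatible Phi Psi) (Hr : dr_compatible Phi Psi).
Variables (v : lifting G S) (v' : lifting G S').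

Hypothesis He : forall X : coalgebra G,
  is_coalgebra_hom (em_tens Phi (lift_ob v X) X) (em_unit Psi) (ev N X).
Hypothesis He' : forall X : coalgebra G,
  is_coalgebra_hom (em_tens Phi X (lift_ob v' X)) (em_unit Psi) (ev' N X).
Hypothesis Hn : forall X : coalgebra G,
  is_coalgebra_hom (em_unit Phi) (em_tens Psi X (lift_ob v X)) (coev N X).
Hypothesis Hn' : forall X : coalgebra G,
  is_coalgebra_hom (em_unit Phi) (em_tens Psi (lift_ob v' X) X) (coev' N X).

(** The lifted functors are negations of the category of coalgebras, with the
    evaluations and coevaluations of [L], once these are coalgebra morphisms. *)
Definition em_negations : negations (L := em_ld Hl Hr) (lift v) (lift v').
Proof.
refine (@Negations (em_ld Hl Hr) (lift v) (lift v')
  (fun X => CoalgebraHom (em_tens Phi (lift_ob v X) X) (em_unit Psi) _ (He X))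
  (fun X => CoalgebraHom (em_tens Phi X (lift_ob v' X)) (em_unit Psi) _ (He' X))
  (fun X => CoalgebraHom (em_unit Phi) (em_tens Psi X (lift_ob v X)) _ (Hn X))
  (fun X => CoalgebraHom (em_unit Phi) (em_tens Psi (lift_ob v' X) X) _ (Hn' X))
  _ _ _ _ _ _ _ _).
1-4: move=> *; apply: coalgebra_hom_eq.
(* An equality of arrows in [em G] up to [heq] needs their endpoints to agree as
   coalgebras; here these are a coalgebra and its tensor with a unit. *)
5-8: move=> *; apply: em_heq; [first [exact: em_tens1o | exact: em_tenso1] |
                               first [exact: em_tens1o | exact: em_tenso1] | ].
- exact: ev_dinat.
- exact: ev'_dinat.
- exact: coev_dinat.
- exact: coev'_dinat.
- exact: triangle_l.
- exact: triangle_r.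
- exact: triangle'_l.
- exact: triangle'_r.
Defined.

End LiftedNegations.

Theorem proposition3p2
  (L : lin_dist_cat) (S S' : contrafunctor L L) (N : negations S S')
  (G : comonad L)
  (Phi : monoidal_comonad ld_star G) (Psi : monoidal_comonad ld_dia G)
  (Hl : dl_compatible Phi Psi) (Hr : dr_compatible Phi Psi)
  (nu : lifting G S) (nu' : lifting G S') :
  (forall A : L,
    mu0 Psi ∘ ev N A ∘ (idm (S A) [⋆] eps G A)
    = fmap G (ev N (G A)) ∘ mu Phi (S (G A)) (G A) ∘ (nu A [⋆] delta G A)
    /\
    fmap G (idm A [⋄] cmap S (eps G A)) ∘ fmap G (coev N A) ∘ mu0 Phi
    = fmap G (idm A [⋄] cmap S (delta G A)) ∘ mu Psi A (S (G (G A)))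
      ∘ (idm (G A) [⋄] nu (G A)) ∘ coev N (G A)
    /\
    mu0 Psi ∘ ev' N A ∘ (eps G A [⋆] idm (S' A))
    = fmap G (ev' N (G A)) ∘ mu Phi (G A) (S' (G A)) ∘ (delta G A [⋆] nu' A)
    /\
    fmap G (cmap S' (eps G A) [⋄] idm A) ∘ fmap G (coev' N A) ∘ mu0 Phi
    = fmap G (cmap S' (delta G A) [⋄] idm A) ∘ mu Psi (S' (G (G A))) A
      ∘ (nu' (G A) [⋄] idm (G A)) ∘ coev' N (G A))
  <->
  (exists N' : negations (L := em_ld Hl Hr) (lift nu) (lift nu'),
    forall X : coalgebra G,
      under (ev N' X) = ev N X /\ under (ev' N' X) = ev' N X /\
      under (coev N' X) = coev N X /\ under (coev' N' X) = coev' N X).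
Proof.
split=> [H | [N' H]].
- have He := proj1 (ev_coalgebra_hom N Phi Psi nu) (fun A => proj1 (H A)).
  have Hn := proj1 (coev_coalgebra_hom N Phi Psi nu)
                   (fun A => proj1 (proj2 (H A))).
  have He' := proj1 (ev'_coalgebra_hom N Phi Psi nu')
                    (fun A => proj1 (proj2 (proj2 (H A)))).
  have Hn' := proj1 (coev'_coalgebra_hom N Phi Psi nu')
                    (fun A => proj2 (proj2 (proj2 (H A)))).
  by exists (em_negations Hl Hr He He' Hn Hn').
- move=> A; split; [|split; [|split]].
  + apply: (proj2 (ev_coalgebra_hom N Phi Psi nu)) => X.
    by case: (H X) => <- _; exact: (underP (ev N' X)).
  + apply: (proj2 (coev_coalgebra_hom N Phi Psi nu)) => X.
    by case: (H X) => _ [_ [<- _]]; exact: (underP (coev N' X)).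
  + apply: (proj2 (ev'_coalgebra_hom N Phi Psi nu')) => X.
    by case: (H X) => _ [<- _]; exact: (underP (ev' N' X)).
  + apply: (proj2 (coev'_coalgebra_hom N Phi Psi nu')) => X.
    by case: (H X) => _ [_ [_ <-]]; exact: (underP (coev' N' X)).
Qed.
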